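(* Let $X$ be a rearrangement invariant Banach lattice on $[a,b]$ and let $\varepsilon>0$. Then, for each $P_n\in\mathcal{P}_n$ and $N\ge\left(\frac8{\log2}+\varepsilon\right)n^2$, we have $$\|P_n\|_X\asymp\bigg\|\sum_{k=1}^N|P_n(x_k)|\chi_{\Omega_k}\bigg\|_X,$$ where $x_k$ is an arbitrary point in $\Omega_k=\left[a+\frac{(b-a)(k-1)}N,\,a+\frac{(b-a)k}N\right]$, $k=1,\dots,N$.
   Context: $[a,b]\subset\mathbb{R}$ is a finite interval with Lebesgue measure $\mu$. A Banach (function) lattice $X$ on $[a,b]$ is a Banach space of functions with a functional $\|\cdot\|_X$ such that: 1) $\|f\|_X=0$ iff $f=0$; 2) $\|\lambda f\|_X=|\lambda|\|f\|_X$ for $\lambda\in\mathbb{C}$; 3) $\|f+g\|_X\le\|f\|_X+\|g\|_X$; 4) if $|f|\le|g|$ then $\|f\|_X\le\|g\|_X$ for $f,g\in X$; 5) $\chi_B\in X$ for all $B$ with $\mu(B)<\infty$; moreover $X\subset L_1$ is assumed. $X$ is rearrangement invariant if $\|f\|_X=\|g\|_X$ whenever $\mu_f=\mu_g$, where $\mu_h(y)=\mu(\{x:|h(x)|\ge y\})$ is the distribution function of $h$. $\mathcal{P}_n$ is the set of algebraic polynomials $\sum_{k=0}^na_kx^k$, $a_k\in\mathbb{C}$, of degree at most $n$. $A\asymp B$ means two-sided inequalities with positive constants independent of the essential variables (here $n$, $N$, $P_n$, and the points $x_k$). *)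

(* Defs.v *)
From HB Require Import structures.
From mathcomp Require Import all_boot all_order all_algebra complex.
From mathcomp Require Import all_classical all_reals all_analysis.

Set Implicit Arguments.
Unset Strict Implicit.
Unset Printing Implicit Defensive.

Import Order.TTheory GRing.Theory Num.Theory.
Import numFieldNormedType.Exports.

Local Open Scope classical_set_scope.
Local Open Scope ring_scope.
Local Open Scope complex_scope.

(* Functions on [a, b] are represented by functions R -> R[i] whose values
   outside [a, b] are irrelevant, and elements of function spaces, which are
   classes modulo almost everywhere equality on [a, b], by their Borel
   representatives. *)

Definition modulus {R : realType} (z : R[i]) : R := ComplexField.Normc.normc z.

Definition ae_on {R : realType} (a b : R) (Q : R -> Prop) : Prop :=
  {ae (@lebesgue_measure R), forall x, `[a, b]%classic x -> Q x}.

Definition measurable_on {R : realType} (a b : R) (f : R -> R[i]) : Prop :=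
  measurable_fun `[a, b] (fun x => complex.Re (f x)) /\
  measurable_fun `[a, b] (fun x => complex.Im (f x)).

Definition L1_on {R : realType} (a b : R) (f : R -> R[i]) : Prop :=
  (@lebesgue_measure R).-integrable `[a, b] (fun x => (complex.Re (f x))%:E) /\
  (@lebesgue_measure R).-integrable `[a, b] (fun x => (complex.Im (f x))%:E).

Definition char_fun {R : realType} (B : set R) : R -> R[i] :=
  fun x => (\1_B x : R)%:C.

(* [bl_complete] together with the vector space and norm axioms makes the
   quotient by almost everywhere equality a Banach space; the norm is
   automatically nonnegative and invariant under almost everywhere equality.
   Monotonicity of the norm is only required between elements of the space, so
   that the space need not be an order ideal. *)
Record banach_lattice (R : realType) (a b : R) := BanachLattice {
  bl_set : set (R -> R[i]);
  bl_norm : (R -> R[i]) -> R;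
  bl_sub_L1 : forall f, bl_set f -> L1_on a b f;
  bl_ae_closed : forall f g, bl_set f -> measurable_on a b g ->
    ae_on a b (fun x => g x = f x) -> bl_set g;
  bl_add : forall f g, bl_set f -> bl_set g -> bl_set (fun x => f x + g x);
  bl_scale : forall (c : R[i]) f, bl_set f -> bl_set (fun x => c * f x);
  bl_abs : forall f, bl_set f -> bl_set (fun x => (modulus (f x))%:C);
  bl_char : forall B, measurable B -> B `<=` `[a, b] ->
    (lebesgue_measure B < +oo)%E -> bl_set (char_fun B);
  bl_norm_eq0 : forall f, bl_set f ->
    (bl_norm f = 0 <-> ae_on a b (fun x => f x = 0));
  bl_normZ : forall (c : R[i]) f, bl_set f ->
    bl_norm (fun x => c * f x) = modulus c * bl_norm f;
  bl_normD : forall f g, bl_set f -> bl_set g ->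
    bl_norm (fun x => f x + g x) <= bl_norm f + bl_norm g;
  bl_norm_le : forall f g, bl_set f -> bl_set g ->
    ae_on a b (fun x => modulus (f x) <= modulus (g x)) ->
    bl_norm f <= bl_norm g;
  bl_complete : forall u : nat -> R -> R[i], (forall k, bl_set (u k)) ->
    (forall e : R, 0 < e -> exists K : nat, forall i j : nat,
      (K <= i)%N -> (K <= j)%N -> bl_norm (fun x => u i x - u j x) < e) ->
    exists2 f, bl_set f &
      bl_norm (fun x => u k x - f x) @[k --> \oo] --> (0 : R)
}.

Definition distribution_fun {R : realType} (a b : R) (h : R -> R[i]) (y : R) :
    \bar R :=
  lebesgue_measure [set x | `[a, b]%classic x /\ y <= modulus (h x)].

Definition rearrangement_invariant (R : realType) (a b : R)
    (X : banach_lattice a b) : Prop :=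
  forall f g, bl_set X f -> bl_set X g ->
    (forall y : R, distribution_fun a b f y = distribution_fun a b g y) ->
    bl_norm X f = bl_norm X g.

Definition poly_fun {R : realType} (P : {poly R[i]}) : R -> R[i] :=
  fun x => P.[x%:C].

Definition Omega {R : realType} (a b : R) (N k : nat) : set R :=
  `[a + (b - a) * (k%:R - 1) / N%:R, a + (b - a) * k%:R / N%:R].

Definition sample_fun {R : realType} (a b : R) (P : {poly R[i]}) (N : nat)
    (x : nat -> R) : R -> R[i] :=
  fun t => \sum_(1 <= k < N.+1)
    (modulus (poly_fun P (x k)))%:C * char_fun (Omega a b N k) t.

(* Main.v *)
(* The heart is a Markov inequality [||P'||_X <= 8 n^2 / (b - a) * ||P||_X] in
   an arbitrary rearrangement invariant [X]. Lagrange interpolation at the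
   extremal points [t_j] of the Chebyshev polynomial of [0, 1] gives [Q'(0) =
   \sum_j l_j Q(t_j)] for [deg Q <= n]; the [l_j] alternate in sign, hence
   testing on the Chebyshev polynomial itself shows [\sum_j |l_j| = 2 n^2].
   With [d = (b - a) / 2] and [Q(s) = P(x + d s)], the restriction of [P'] to
   the left half of [a, b] is a combination of translates of restrictions of
   [P], each equimeasurable with a function dominated by [|P|]; [d = - (b - a)
   / 2] treats the right half. Iterating in Taylor's formula on each cell, the
   sampled function differs from [|P|] by a function of norm at most [(e^q - 1)
   ||P||_X] with [q = 8 n^2 / N], and [q] stays
   below a constant smaller than [ln 2]. *)
Require Import Defs.
From mathcomp Require Import all_boot all_order all_algebra complex.
From mathcomp Require Import all_classical all_reals all_analysis.
From mathcomp Require Import measurable_realfun zify ring lra.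

Import Order.TTheory GRing.Theory Num.Theory.
Import numFieldNormedType.Exports.
Local Open Scope classical_set_scope.
Local Open Scope ring_scope.
Local Open Scope complex_scope.

(** * Quadrature for the derivative at an endpoint *)

(* [cheb n] is [T_n(1 - 2 X)], the Chebyshev polynomial of [0, 1]. *)
Fixpoint cheb {R : comNzRingType} (n : nat) : {poly R} :=
  match n with
  | 0 => 1
  | 1 => 1 - 2%:P * 'X
  | (m.+1 as k).+1 => 2%:P * (1 - 2%:P * 'X) * cheb k - cheb m
  end.

Lemma chebSS (R : comNzRingType) n :
  cheb n.+2 = 2%:P * (1 - 2%:P * 'X) * cheb n.+1 - cheb n :> {poly R}.
Proof. by []. Qed.

Lemma nat_ind2 (Q : nat -> Prop) :
  Q 0%N -> Q 1%N -> (forall n, Q n -> Q n.+1 -> Q n.+2) -> forall n, Q n.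
Proof.
move=> Q0 Q1 QSS n; suff [] : Q n /\ Q n.+1 by [].
by elim: n => [|n [IH1 IH2]]; split=> //; exact: QSS.
Qed.

Lemma size_cheb (R : comNzRingType) n : (size (cheb n : {poly R}) <= n.+1)%N.
Proof.
have sL : (size (1 - 2%:P * 'X : {poly R})%R <= 2)%N.
  rewrite (leq_trans (size_polyD _ _))// geq_max size_poly1/= size_polyN.
  by rewrite mul_polyC (leq_trans (size_scale_leq _ _))// size_polyX.
elim/nat_ind2: n => [||n IH1 IH2]; rewrite ?size_poly1//.
rewrite chebSS (leq_trans (size_polyD _ _))// geq_max size_polyN.
apply/andP; split; last exact: leq_trans IH1 (leqW (leqnSn _)).
rewrite -mulrA mul_polyC (leq_trans (size_scale_leq _ _))//.
rewrite (leq_trans (size_polyMleq _ _))// -[n.+3]/(2 + n.+2).-1 -!subn1.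
by rewrite leq_sub2r// leq_add.
Qed.

Lemma horner_cheb_cos (R : realType) n (x : R) :
  (cheb n).[(1 - cos x) / 2] = cos (n%:R * x).
Proof.
elim/nat_ind2: n => [||n IH1 IH2].
- by rewrite /= hornerE mul0r cos0.
- by rewrite /= !hornerE /=; field.
rewrite chebSS !(hornerE, IH1, IH2) /=.
have -> : n.+2%:R * x = n.+1%:R * x + x by rewrite -natr1 mulrDl mul1r.
have -> : n%:R * x = n.+1%:R * x - x by rewrite -natr1; ring.
by rewrite cosB cosD; field.
Qed.

Lemma horner_cheb0 (R : comNzRingType) n : (cheb n : {poly R}).[0] = 1.
Proof.
elim/nat_ind2: n => [||n IH1 IH2].
- by rewrite /= hornerE.
- by rewrite /= !hornerE /=; ring.
by rewrite chebSS !(hornerE, IH1, IH2) /=; ring.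
Qed.

Lemma deriv_cheb0 (R : comNzRingType) n :
  (cheb n : {poly R})^`().[0] = - 2 * n%:R ^+ 2.
Proof.
elim/nat_ind2: n => [||n IH1 IH2].
- by rewrite /= derivC horner0; ring.
- by rewrite /= !poly.derivE !hornerE /=; ring.
rewrite chebSS !poly.derivE !hornerE IH1 IH2 !horner_cheb0 -!natr1 /=; ring.
Qed.

Definition cheb_node {R : realType} (n j : nat) : R :=
  (1 - cos (j%:R * pi / n%:R)) / 2.
Arguments cheb_node : simpl never.

Lemma cheb_node0 (R : realType) n : cheb_node n 0 = 0 :> R.
Proof. by rewrite /cheb_node !mul0r cos0 subrr mul0r. Qed.

Lemma cheb_node_itv (R : realType) n j : 0 <= (cheb_node n j : R) <= 1.
Proof.
rewrite /cheb_node; have := cos_geN1 (j%:R * pi / n%:R : R).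
by have := cos_le1 (j%:R * pi / n%:R : R); lra.
Qed.

Lemma cheb_node_lt (R : realType) n i j : (i < j <= n)%N ->
  cheb_node n i < cheb_node n j :> R.
Proof.
move=> /andP[ij jn]; have n0 : 0 < n%:R :> R by rewrite ltr0n; lia.
have lt_arg : i%:R * pi / n%:R < j%:R * pi / n%:R :> R.
  by rewrite ltr_pM2r ?invr_gt0// ltr_pM2r ?pi_gt0// ltr_nat.
have in_itv k : (k <= n)%N -> k%:R * pi / n%:R \in `[0 : R, pi].
  move=> kn; rewrite in_itv/= !mulr_ge0 ?invr_ge0 ?pi_ge0//=.
  by rewrite ler_pdivrMr// mulrC ler_pM2l ?pi_gt0// ler_nat.
have := @ltr_cos R (i%:R * pi / n%:R) (j%:R * pi / n%:R).
rewrite lt_arg !in_itv//; last lia.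
by rewrite /cheb_node => /(_ erefl erefl) h; lra.
Qed.

Lemma horner_cheb_node (R : realType) n j : (0 < n)%N ->
  (cheb n).[cheb_node n j] = (-1) ^+ j :> R.
Proof.
move=> n0; rewrite horner_cheb_cos mulrC divfK ?pnatr_eq0 -?lt0n//.
elim: j => [|j IH]; first by rewrite mul0r cos0.
by rewrite -natr1 mulrDl mul1r cosDpi IH exprS mulN1r.
Qed.

(* The sign condition is stated on [p'(0) p(0)] because in this form it is stable
   under products. *)
Lemma deriv_mul_prod_XsubC_le0 (R : realFieldType) (I : Type) (s : seq I)
    (Q : pred I) (t : I -> R) : (forall i, 0 <= t i) ->
  let p := \prod_(i <- s | Q i) ('X - (t i)%:P) in p^`().[0] * p.[0] <= 0.
Proof.
move=> t0 /=; elim/big_ind : _ => [|p q hp hq|i _].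
- by rewrite derivC !hornerE.
- rewrite derivM hornerD !hornerM.
  have -> : (p^`().[0] * q.[0] + p.[0] * q^`().[0]) * (p.[0] * q.[0]) =
    p^`().[0] * p.[0] * q.[0] ^+ 2 + q^`().[0] * q.[0] * p.[0] ^+ 2 by ring.
  by rewrite -[leRHS]addr0 lerD// mulr_le0_ge0// sqr_ge0.
- by rewrite derivXsubC hornerC hornerXsubC mul1r sub0r oppr_le0.
Qed.

Lemma prod_sign_lt (R : comNzRingType) (j m : nat) :
  \prod_(i < m) (if (0 < i < j)%N then -1 else 1) = (-1) ^+ (minn j m).-1 :> R.
Proof.
elim: m => [|m IH]; first by rewrite big_ord0 minn0.
rewrite big_ord_recr /= IH; case: (posnP m) => [->|m0] /=.
  by rewrite minn0 mulr1; case: j {IH} => // j; rewrite minSS minn0.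
case: (boolP (m < j)%N) => [jm|]; last rewrite -leqNgt => jm.
  rewrite (minn_idPr (ltnW jm)) (minn_idPr jm) -exprSr.
  by rewrite prednK.
by rewrite mulr1 (minn_idPl jm) (minn_idPl (leqW jm)).
Qed.

Section markov_quadrature.
Context {R : realType}.
Variable n : nat.
Hypothesis n_gt0 : (0 < n)%N.

Let t (i : 'I_n.+1) : R := cheb_node n i.

Let t_lt (i j : 'I_n.+1) : (i < j)%N -> t i < t j.
Proof. by move=> ij; rewrite cheb_node_lt// ij -ltnS ltn_ord. Qed.

Let t_inj : injective t.
Proof.
move=> i j tij; apply/val_inj => /=; case: (ltngtP i j) => // /t_lt.
  by rewrite tij ltxx.
by rewrite tij ltxx.
Qed.

Let t0 : t ord0 = 0. Proof. exact: cheb_node0. Qed.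

Let t_ge0 i : 0 <= t i.
Proof. by have /andP[] := @cheb_node_itv R n i. Qed.

Let t_gt0 i : i != ord0 -> 0 < t i.
Proof. by move=> i0; rewrite -t0 t_lt// lt0n. Qed.

Let nodal j : {poly R} := \prod_(i < n.+1 | i != j) ('X - (t i)%:P).
Let lag j : {poly R} := (nodal j).[t j]^-1 *: nodal j.
Let wgt j : R := (lag j)^`().[0].

Let horner_nodal j x : (nodal j).[x] = \prod_(i < n.+1 | i != j) (x - t i).
Proof. by rewrite horner_prod; apply: eq_bigr => i _; rewrite hornerXsubC. Qed.

Let nodal_neq0 j : (nodal j).[t j] != 0.
Proof.
rewrite horner_nodal; apply/prodf_neq0 => i ij; rewrite subr_eq0.
by apply: contra ij => /eqP/t_inj ->.
Qed.

Let lag_node i j : (lag j).[t i] = (i == j)%:R.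
Proof.
rewrite hornerZ; have [->|ij] := eqVneq i j; first by rewrite mulVf.
by rewrite [(nodal j).[t i]]horner_nodal (bigD1 i)//= subrr mul0r mulr0.
Qed.

Let size_lag j : (size (lag j) <= n.+1)%N.
Proof.
rewrite (leq_trans (size_scale_leq _ _))// /nodal -big_filter.
case: big_enumP => e _ _ [_ se].
by rewrite size_prod_XsubC se cardC1 card_ord.
Qed.

Let horner0_map (p : {poly R}) : (map_poly (real_complex R) p).[0] = (p.[0])%:C.
Proof. by rewrite -(horner_map (real_complex R)) rmorph0. Qed.

Let wgtE (Q : {poly R[i]}) : (size Q <= n.+1)%N ->
  Q^`().[0] = \sum_j (wgt j)%:C * Q.[(t j)%:C].
Proof.
move=> sQ; pose mp := map_poly (real_complex R).
have mp_node j k : (mp (lag j)).[(t k)%:C] = (k == j)%:R.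
  by rewrite horner_map /= lag_node; case: eqP; rewrite ?rmorph1 ?rmorph0.
suff QE : Q = \sum_j Q.[(t j)%:C] *: mp (lag j).
  rewrite {1}QE raddf_sum horner_sum; apply: eq_bigr => j _.
  by rewrite /= derivZ hornerZ /mp deriv_map horner0_map mulrC.
apply/eqP; rewrite -subr_eq0; apply/eqP.
apply: (@roots_geq_poly_eq0 _ _ [seq (t j)%:C | j <- enum 'I_n.+1]).
- apply/allP => _ /mapP[k _ ->]; rewrite rootE hornerD hornerN horner_sum.
  rewrite (bigD1 k)//= hornerZ mp_node eqxx mulr1 big1 ?addr0 ?subrr// => j jk.
  by rewrite hornerZ mp_node eq_sym (negbTE jk) mulr0.
- by rewrite map_inj_uniq ?enum_uniq// => j k [/t_inj].
rewrite size_map size_enum_ord (leq_trans (size_polyD _ _))// geq_max sQ.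
rewrite size_polyN (leq_trans (size_sum _ _ _))//; apply/bigmax_leqP => j _.
by rewrite (leq_trans (size_scale_leq _ _))// (leq_trans (size_poly _ _)).
Qed.

Let sgr_wgt (j : 'I_n.+1) : wgt j * (-1) ^+ j <= 0.
Proof.
rewrite /wgt derivZ hornerZ; have [->|j0] := eqVneq j ord0.
  rewrite expr0 mulr1 t0; set d := _^`().[0]; set p := _.[0].
  have -> : p^-1 * d = d * p * p^-1 ^+ 2.
    by have := nodal_neq0 ord0; rewrite t0 -/p => ?; field.
  by apply: mulr_le0_ge0; [exact: deriv_mul_prod_XsubC_le0|exact: sqr_ge0].
have -> : (nodal j)^`().[0] =
    \prod_(i < n.+1 | (i != j) && (i != ord0)) (- t i).
  rewrite /nodal (bigD1 ord0) 1?eq_sym//= derivM derivXsubC mul1r hornerD.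
  rewrite hornerM hornerXsubC t0 subrr mul0r addr0 horner_prod.
  apply: eq_bigr => i _.
  by rewrite hornerXsubC sub0r.
rewrite horner_nodal (bigD1 ord0) 1?eq_sym//= t0 subr0 invfM -!mulrA.
rewrite pmulr_rle0 ?invr_gt0 ?t_gt0// mulrA -prodfV -big_split/=.
have -> : (-1) ^+ j = - (-1) ^+ (minn j n.+1).-1 :> R.
  rewrite (minn_idPl (ltnW (ltn_ord j))) -[in LHS](prednK (n := j)) ?lt0n//.
  by rewrite exprS mulN1r.
rewrite mulrN oppr_le0 -prod_sign_lt big_mkcond -big_split/= prodr_ge0// => i _.
case: ifPn => [/andP[ij i0]|]; last first.
  rewrite negb_and !negbK => /orP[]/eqP->; by rewrite ?ltnn ?andbF mul1r.
rewrite lt0n -(inj_eq val_inj) /= in i0 *; rewrite i0 /=.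
case: ltnP => [ij'|ji].
  rewrite mulrN1 mulrN opprK mulr_ge0// invr_ge0 subr_ge0 ltW// t_lt//.
rewrite mulr1 mulrN -mulNr -invrN opprB mulr_ge0// invr_ge0 subr_ge0.
rewrite ltW// t_lt//.
by rewrite ltn_neqAle ji andbT eq_sym.
Qed.

Let sum_norm_wgt : \sum_j `|wgt j| = 2 * n%:R ^+ 2.
Proof.
apply: complexI.
have := @wgtE (map_poly (real_complex R) (cheb n)).
rewrite (leq_trans (size_poly _ _)) ?size_cheb// => /(_ isT).
rewrite deriv_map horner0_map/=.
rewrite deriv_cheb0 mulNr rmorphN => /(congr1 -%R); rewrite opprK => ->.
rewrite rmorph_sum -sumrN; apply: eq_bigr => j _.
rewrite horner_map /= -rmorphM -rmorphN; congr (_%:C).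
rewrite horner_cheb_node//; have := sgr_wgt j.
rewrite -signr_odd; case: odd; rewrite ?expr0 ?expr1 ?mulr1 ?mulrN1.
  by rewrite oppr_le0 opprK => /ger0_norm.
by move/ler0_norm.
Qed.

Lemma markov_quadrature_pos : exists l t : 'I_n.+1 -> R,
  [/\ forall j, 0 <= t j <= 1, \sum_j `|l j| <= 2 * n%:R ^+ 2 &
    forall Q : {poly R[i]}, (size Q <= n.+1)%N ->
      Q^`().[0] = \sum_j (l j)%:C * Q.[(t j)%:C]].
Proof.
exists wgt, t; split; last exact: wgtE; last by rewrite sum_norm_wgt.
by move=> j; exact: cheb_node_itv.
Qed.

End markov_quadrature.

Lemma markov_quadrature (R : realType) n : exists l t : 'I_n.+1 -> R,
  [/\ forall j, 0 <= t j <= 1, \sum_j `|l j| <= 2 * n%:R ^+ 2 &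
    forall Q : {poly R[i]}, (size Q <= n.+1)%N ->
      Q^`().[0] = \sum_j (l j)%:C * Q.[(t j)%:C]].
Proof.
case: n => [|n]; last exact: markov_quadrature_pos.
exists (fun=> 0), (fun=> 0); split=> [j||Q /size1_polyC ->].
- by rewrite lexx ler01.
- by rewrite big1 ?expr0n ?mulr0// => j _; rewrite normr0.
- by rewrite derivC horner0 big1// => j _; rewrite rmorph0 mul0r.
Qed.

(** * Banach lattices of functions *)

Section modulus_theory.
Context {R : realType}.
Implicit Types z w : R[i].

Lemma modulusM z w : modulus (z * w) = modulus z * modulus w.
Proof. exact: ComplexField.Normc.normcM. Qed.

Lemma modulusD z w : modulus (z + w) <= modulus z + modulus w.
Proof. exact: (@le_normcD R). Qed.

Lemma modulusN z : modulus (- z) = modulus z.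
Proof. exact: (@normcN R). Qed.

Lemma modulusC (x : R) : modulus x%:C = `|x|.
Proof. by rewrite /modulus /= expr0n/= addr0 sqrtr_sqr. Qed.

Lemma modulus0 : modulus (0 : R[i]) = 0.
Proof. by rewrite modulusC normr0. Qed.

Lemma modulus_ge0 z : 0 <= modulus z.
Proof. by case: z => x y; exact: sqrtr_ge0. Qed.

Lemma modulus_eq0 z : modulus z = 0 -> z = 0.
Proof. exact: ComplexField.Normc.eq0_normc. Qed.

Lemma modulusB z w : modulus (z - w) = modulus (w - z).
Proof. by rewrite -modulusN opprB. Qed.

Lemma modulusE z : modulus z = Num.sqrt (complex.Re z ^+ 2 + complex.Im z ^+ 2).
Proof. by case: z. Qed.

Lemma Re_le_modulus z : `|complex.Re z| <= modulus z.
Proof. by rewrite modulusE -sqrtr_sqr ler_wsqrtr// lerDl sqr_ge0. Qed.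

Lemma Im_le_modulus z : `|complex.Im z| <= modulus z.
Proof. by rewrite modulusE -sqrtr_sqr ler_wsqrtr// lerDr sqr_ge0. Qed.

Lemma modulus_sum (I : Type) (s : seq I) (F : I -> R[i]) :
  modulus (\sum_(i <- s) F i) <= \sum_(i <- s) modulus (F i).
Proof.
elim/big_rec2: _ => [|i y z _ h]; first by rewrite modulus0.
by rewrite (le_trans (modulusD _ _))// lerD2l.
Qed.

Lemma char_fun1 (B : set R) x : B x -> char_fun B x = 1.
Proof. by move=> Bx; rewrite /char_fun indicE mem_set. Qed.

Lemma char_fun0 (B : set R) x : ~ B x -> char_fun B x = 0.
Proof. by move=> Bx; rewrite /char_fun indicE memNset. Qed.

Lemma modulus_char (B : set R) x : modulus (char_fun B x) <= 1.
Proof. by rewrite modulusC indicE ger0_norm// lern1 leq_b1. Qed.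

End modulus_theory.

Section banach_lattice_theory.
Context {R : realType} {a b : R} (hab : a < b) (X : banach_lattice a b).
Local Notation nrm := (bl_norm X).

Lemma ae_on_all (Q : R -> Prop) : (forall x, `[a, b]%classic x -> Q x) ->
  ae_on a b Q.
Proof. by move=> h; exact: aeW. Qed.

Lemma ae_onS (P Q : R -> Prop) :
  (forall x, `[a, b]%classic x -> P x -> Q x) -> ae_on a b P -> ae_on a b Q.
Proof.
move=> PQ; apply: (@filterS _ _ (ae_filter_ringOfSetsType lebesgue_measure)).
by move=> x Px xab; exact/PQ/Px.
Qed.

Lemma bl_char_sub (B : set R) : measurable B -> B `<=` `[a, b] ->
  bl_set X (char_fun B).
Proof.
move=> mB sB; apply: bl_char => //.
apply: (@le_lt_trans _ _ (lebesgue_measure `[a, b])).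
  by apply: le_measure; rewrite ?inE.
by rewrite lebesgue_measure_itv/= lte_fin hab -EFinD ltry.
Qed.

Lemma bl_char_itv : bl_set X (char_fun `[a, b]).
Proof. exact: bl_char_sub. Qed.

Lemma bl_set0 : bl_set X (fun=> 0).
Proof.
have := bl_scale 0 bl_char_itv; congr (bl_set X _).
by apply/funext => x; rewrite mul0r.
Qed.

Lemma bl_norm0 : nrm (fun=> 0) = 0.
Proof. by apply/(bl_norm_eq0 bl_set0); exact: ae_on_all. Qed.

Lemma bl_norm_mono {f g : R -> R[i]} : bl_set X f -> bl_set X g ->
  (forall x, `[a, b]%classic x -> modulus (f x) <= modulus (g x)) ->
  nrm f <= nrm g.
Proof. by move=> Xf Xg fg; apply: bl_norm_le => //; exact: ae_on_all. Qed.

Lemma bl_norm_ge0 {f : R -> R[i]} : bl_set X f -> 0 <= nrm f.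
Proof.
move=> Xf; rewrite -bl_norm0; apply: bl_norm_mono => //; first exact: bl_set0.
by move=> x _; rewrite modulus0 modulus_ge0.
Qed.

Lemma bl_sub {f g : R -> R[i]} : bl_set X f -> bl_set X g ->
  bl_set X (fun x => f x - g x).
Proof.
move=> Xf Xg; have := bl_add Xf (bl_scale (-1) Xg); congr (bl_set X _).
by apply/funext => x; rewrite mulN1r.
Qed.

Lemma bl_sum (I : eqType) (s : seq I) (F : I -> R -> R[i]) :
  (forall i, i \in s -> bl_set X (F i)) ->
  bl_set X (fun x => \sum_(i <- s) F i x).
Proof.
elim: s => [|i s IH] XF.
  have := bl_set0; congr (bl_set X _).
  by apply/funext => x; rewrite big_nil.
have Xs : bl_set X (fun x => \sum_(j <- s) F j x).
  by apply: IH => j js; apply: XF; rewrite inE js orbT.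
have := bl_add (XF i (mem_head _ _)) Xs; congr (bl_set X _).
by apply/funext => x; rewrite big_cons.
Qed.

Lemma bl_norm_sum (I : eqType) (s : seq I) (F : I -> R -> R[i]) :
  (forall i, bl_set X (F i)) ->
  nrm (fun x => \sum_(i <- s) F i x) <= \sum_(i <- s) nrm (F i).
Proof.
move=> XF; elim: s => [|i s IH].
  rewrite big_nil; under eq_fun do rewrite big_nil.
  by rewrite bl_norm0.
rewrite big_cons; under eq_fun do rewrite big_cons.
rewrite (le_trans (bl_normD (XF i) _)) ?lerD2l//.
by apply: bl_sum => j _; exact: XF.
Qed.

Lemma bl_norm_bounded {f : R -> R[i]} (c : R) : 0 <= c -> bl_set X f ->
  (forall x, `[a, b]%classic x -> modulus (f x) <= c) ->
  nrm f <= c * nrm (char_fun `[a, b]).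
Proof.
move=> c0 Xf fc.
have <- : modulus c%:C = c by rewrite modulusC ger0_norm.
rewrite -bl_normZ; last exact: bl_char_itv.
apply: bl_norm_mono => // [|x xab]; first exact: bl_scale bl_char_itv.
by rewrite char_fun1// mulr1 modulusC ger0_norm// fc.
Qed.

(* The function [w = 2 (|g - u_k| - c)^+] lies in [X] and is dominated by
   [2 |u_j - g|] for every [j >= k], so its norm vanishes. *)
Lemma bl_limit_dist (u : nat -> R -> R[i]) (g : R -> R[i]) (c : R) (k : nat) :
  0 <= c -> (forall j, bl_set X (u j)) -> bl_set X g ->
  nrm (fun x => u j x - g x) @[j --> \oo] --> (0 : R) ->
  (forall j x, (k <= j)%N -> `[a, b]%classic x ->
    modulus (u j x - u k x) <= c) ->
  ae_on a b (fun x => modulus (g x - u k x) <= c).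
Proof.
move=> c0 Xu Xg ug uc.
pose r x : R[i] := (modulus (g x - u k x))%:C - c%:C * char_fun `[a, b] x.
have Xr : bl_set X r.
  apply: bl_sub; first exact: bl_abs (bl_sub Xg (Xu k)).
  exact: bl_scale bl_char_itv.
pose w x : R[i] := r x + (modulus (r x))%:C.
have Xw : bl_set X w by apply: bl_add => //; exact: bl_abs.
have wE x : `[a, b]%classic x ->
    w x = ((modulus (g x - u k x) - c) + `|modulus (g x - u k x) - c|)%:C.
  move=> xab; rewrite /w /r char_fun1// mulr1 -rmorphB modulusC.
  by rewrite -rmorphD.
suff w0 : nrm w = 0.
  move/(bl_norm_eq0 Xw) : w0; apply: ae_onS => x xab.
  rewrite wE// => /complexI; set d := (_ - c); rewrite -subr_le0 -/d.
  by have := ler_norm d; have := normr_ge0 d; lra.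
apply/eqP; rewrite eq_le (bl_norm_ge0 Xw) andbT.
have : 2 * nrm (fun x => u j x - g x) @[j --> \oo] --> (2 * 0 : R).
  by apply: cvgM => //; exact: cvg_cst.
rewrite mulr0 => /cvgr_to_ge; apply.
near=> j.
have -> : 2 = modulus (2%:R : R[i]).
  by rewrite -(rmorph_nat (real_complex R)) modulusC ger0_norm.
rewrite -bl_normZ; last exact: bl_sub.
apply: bl_norm_mono => //; first by apply: bl_scale; exact: bl_sub.
move=> x xab; rewrite wE// modulusC modulusM.
have -> : modulus (2%:R : R[i]) = 2.
  by rewrite -(rmorph_nat (real_complex R)) modulusC ger0_norm.
have kj : (k <= j)%N by near: j; exists k.
have := modulusD (g x - u j x) (u j x - u k x); rewrite addrA subrK.
rewrite (modulusB (g x) (u j x)) => h1; have h2 := uc j x kj xab.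
set d := _ - c; have dle : d <= modulus (u j x - g x) by rewrite /d; lra.
rewrite ger0_norm; last by have := ler_norm (- d); rewrite normrN; lra.
have := modulus_ge0 (u j x - g x); case: (lerP 0 d) => [d0|d0].
  by rewrite ger0_norm//; lra.
by rewrite ltr0_norm//; lra.
Unshelve. all: by end_near. Qed.

Lemma bl_set_unif_limit (u : nat -> R -> R[i]) (f : R -> R[i]) :
  (forall k, bl_set X (u k)) -> measurable_on a b f ->
  (forall k x, `[a, b]%classic x -> modulus (u k x - f x) <= k.+1%:R^-1) ->
  bl_set X f.
Proof.
move=> Xu mf uf.
have uu k i j x : (k <= i)%N -> (k <= j)%N -> `[a, b]%classic x ->
    modulus (u i x - u j x) <= 2 * k.+1%:R^-1.
  move=> ki kj xab; have := modulusD (u i x - f x) (f x - u j x).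
  rewrite addrA subrK (modulusB (f x)) => h; rewrite (le_trans h)//.
  have lei : i.+1%:R^-1 <= k.+1%:R^-1 :> R by rewrite lef_pV2 ?posrE// ler_nat.
  have lej : j.+1%:R^-1 <= k.+1%:R^-1 :> R by rewrite lef_pV2 ?posrE// ler_nat.
  by rewrite mulr_natl mulr2n lerD// (le_trans (uf _ _ xab)).
have [e e0|g Xg ug] := @bl_complete _ _ _ X u Xu.
  set C := nrm (char_fun `[a, b]).
  have C0 : 0 <= C by exact: bl_norm_ge0 bl_char_itv.
  exists (Num.truncn (2 * C / e)) => i j; set k := Num.truncn _ => ki kj.
  apply: (@le_lt_trans _ _ (2 * k.+1%:R^-1 * C)).
    apply: bl_norm_bounded; rewrite ?mulr_ge0//; first exact: bl_sub.
    by move=> x; exact: uu.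
  have := truncnS_gt (2 * C / e); rewrite -/k ltr_pdivrMr//.
  by rewrite mulrAC ltr_pdivrMr// (mulrC e).
have gu k : ae_on a b (fun x => modulus (g x - u k x) <= 2 * k.+1%:R^-1).
  apply: bl_limit_dist => // j x kj xab.
  exact: (uu k).
apply: (bl_ae_closed Xg mf); move/ae_foralln : gu.
apply: (@filterS _ _ (ae_filter_ringOfSetsType lebesgue_measure)) => x gu xab.
apply/esym/eqP; rewrite -subr_eq0; apply/eqP/modulus_eq0/eqP.
rewrite eq_le modulus_ge0 andbT; apply/ler_addgt0Pr => e e0; rewrite add0r.
pose k := Num.truncn (3 / e).
have h1 := gu k xab; have h2 := uf k x xab.
have := modulusD (g x - u k x) (u k x - f x); rewrite addrA subrK => h3.
have : 3 * k.+1%:R^-1 < e.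
  by have := truncnS_gt (3 / e); rewrite -/k ltr_pdivrMr// ltr_pdivrMr// mulrC.
move=> /ltW; apply: le_trans; apply: (le_trans h3).
by rewrite (le_trans (lerD h1 h2))// -[X in _ + X]mul1r -mulrDl natr1.
Qed.

End banach_lattice_theory.

Lemma staircase (R : realType) (z : R) (K : nat) : 0 <= z <= K%:R ->
  0 <= z - \sum_(i < K) (if i.+1%:R <= z then 1 else 0) <= 1.
Proof.
elim: K => [|K IH] in z *.
  by rewrite big_ord0 subr0 => /andP[-> /le_trans ->].
move=> /andP[z0 zK]; rewrite big_ord_recr/=; have [zK'|zK'] := leP z K%:R.
  rewrite (leNgt K.+1%:R) (le_lt_trans zK') ?ltr_nat// addr0.
  by apply: IH; rewrite z0.
rewrite (eq_bigr (fun=> 1)) => [|i _]; last first.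
  by rewrite ifT// (le_trans _ (ltW zK'))// ler_nat.
rewrite sumr_const card_ord -[1 *+ K]/(K%:R).
by move: zK; rewrite -natr1; case: ifPn => zS; lra.
Qed.

Section bounded_measurable.
Context {R : realType} {a b : R} (hab : a < b) (X : banach_lattice a b).

Lemma bl_set_bounded_nneg (f : R -> R) (M : R) :
  measurable_fun `[a, b] f ->
  (forall x, `[a, b]%classic x -> 0 <= f x <= M) ->
  bl_set X (fun x => (f x)%:C).
Proof.
move=> mf fM; pose B k i := `[a, b] `&` [set x | i.+1%:R <= f x * k.+1%:R].
pose K k := (Num.truncn (M * k.+1%:R)).+1.
pose u k x : R[i] := k.+1%:R^-1%:C * \sum_(i < K k) char_fun (B k i) x.
have mB k i : measurable (B k i).
  apply: measurable_fun_le => //; exact: measurable_funM.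
apply: (@bl_set_unif_limit _ _ _ hab X u).
- move=> k; apply: bl_scale; apply: bl_sum => // i _.
  by apply: bl_char_sub => //; exact: subIsetl.
- split => /=; [exact: mf|exact: measurable_cst].
move=> k x xab; rewrite /u.
have -> : \sum_(i < K k) char_fun (B k i) x =
    (\sum_(i < K k) (if i.+1%:R <= f x * k.+1%:R then 1 else 0))%:C :> R[i].
  rewrite rmorph_sum; apply: eq_bigr => i _; case: ifPn => h.
    by rewrite char_fun1.
  by rewrite char_fun0// => -[_]; apply/negP.
rewrite -rmorphM -rmorphB modulusC.
have /andP[f0 fM'] := fM x xab.
have : 0 <= f x * k.+1%:R <= (K k)%:R.
  rewrite mulr_ge0//=; apply: le_trans (ltW (truncnS_gt _)).
  by rewrite ler_pM2r.
move/staircase => /andP[]; set S := \sum_(i < _) _ => h1 h2.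
have -> : k.+1%:R^-1 * S - f x = - ((f x * k.+1%:R - S) * k.+1%:R^-1).
  by field.
rewrite normrN ger0_norm ?mulr_ge0//.
by rewrite -[leRHS]mul1r ler_pM2r// invr_gt0.
Qed.

Lemma bl_set_bounded (f : R -> R[i]) (M : R) : measurable_on a b f ->
  (forall x, `[a, b]%classic x -> modulus (f x) <= M) -> bl_set X f.
Proof.
move=> [mRe mIm] fM.
have main (g : R -> R) : measurable_fun `[a, b] g ->
    (forall x, `[a, b]%classic x -> `|g x| <= M) ->
    bl_set X (fun x => (g x)%:C).
  move=> mg gM.
  have M0 : 0 <= M by apply: le_trans (gM a _); rewrite //= in_itv/= lexx ltW.
  have h1 := @bl_set_bounded_nneg (fun x => g x + M) (M + M).
  have h2 := @bl_set_bounded_nneg (fun=> M) M.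
  have := bl_sub X (h1 _ _) (h2 _ _).
  rewrite (_ : (fun x => _) = (fun x => (g x)%:C)).
    apply=> //.
    - exact: measurable_funD.
    - by move=> x /gM; rewrite ler_norml => /andP[? ?]; lra.
    - by move=> x _; rewrite M0 lexx.
  by apply/funext => x; rewrite -rmorphB addrK.
have -> : f = (fun x => (complex.Re (f x))%:C + 'i * (complex.Im (f x))%:C).
  by apply/funext => x; rewrite [LHS]complexE.
apply: bl_add; first by apply: main => // x /fM; exact/le_trans/Re_le_modulus.
by apply: bl_scale; apply: main => // x /fM; exact/le_trans/Im_le_modulus.
Qed.

Lemma Re_poly_fun (P : {poly R[i]}) :
  (fun x => complex.Re (poly_fun P x)) = horner (map_poly (@complex.Re R) P).
Proof.
apply/funext => x; rewrite /poly_fun horner_coef.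
rewrite (horner_coef_wide _ (size_poly _ _)).
rewrite raddf_sum; apply: eq_bigr => i _.
rewrite coef_map -rmorphXn.
by case: (P`_i) => u v; simpc.
Qed.

Lemma Im_poly_fun (P : {poly R[i]}) :
  (fun x => complex.Im (poly_fun P x)) = horner (map_poly (@complex.Im R) P).
Proof.
apply/funext => x; rewrite /poly_fun horner_coef.
rewrite (horner_coef_wide _ (size_poly _ _)).
rewrite raddf_sum; apply: eq_bigr => i _.
rewrite coef_map -rmorphXn.
by case: (P`_i) => u v; simpc.
Qed.

Lemma measurable_on_char_poly (B : set R) (P : {poly R[i]}) : measurable B ->
  measurable_on a b (fun x => char_fun B x * poly_fun P x).
Proof.
move=> mB; split.
  rewrite (_ : (fun _ => _) = \1_B \* (fun x => complex.Re (poly_fun P x))).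
    apply: measurable_funM; first exact: measurable_indic.
    rewrite Re_poly_fun; apply: measurable_funTS.
    apply: continuous_measurable_fun.
    exact: continuous_horner.
  by apply/funext => x; rewrite /char_fun /=; case: poly_fun => u v; simpc.
rewrite (_ : (fun _ => _) = \1_B \* (fun x => complex.Im (poly_fun P x))).
  apply: measurable_funM; first exact: measurable_indic.
  rewrite Im_poly_fun; apply: measurable_funTS.
  apply: continuous_measurable_fun.
  exact: continuous_horner.
by apply/funext => x; rewrite /char_fun /=; case: poly_fun => u v; simpc.
Qed.

Lemma modulus_poly_fun_bound (P : {poly R[i]}) : exists M : R,
  forall x, `[a, b]%classic x -> modulus (poly_fun P x) <= M.
Proof.
exists (\sum_(i < size P) modulus P`_i * (`|a| + `|b|) ^+ i) => x.
rewrite /= in_itv/= => /andP[ax xb]; rewrite /poly_fun horner_coef.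
rewrite (le_trans (modulus_sum _ _ _))//; apply: ler_sum => i _.
rewrite modulusM ler_wpM2l ?modulus_ge0// -rmorphXn modulusC normrX.
rewrite lerXn2r ?nnegrE ?addr_ge0// ler_norml.
have := ler_norm b; have := ler_norm (- a); rewrite normrN.
by have := normr_ge0 a; have := normr_ge0 b; lra.
Qed.

Lemma bl_char_poly (B : set R) (P : {poly R[i]}) : measurable B ->
  bl_set X (fun x => char_fun B x * poly_fun P x).
Proof.
move=> mB; have [M PM] := modulus_poly_fun_bound P.
apply: (@bl_set_bounded _ M); first exact: measurable_on_char_poly.
move=> x xab; rewrite modulusM -[leRHS]mul1r.
rewrite ler_pM ?modulus_ge0 ?modulus_char//.
exact: PM.
Qed.

Lemma bl_poly (P : {poly R[i]}) : bl_set X (poly_fun P).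
Proof.
have := bl_char_poly setT P measurableT; congr (bl_set X _).
by apply/funext => x; rewrite char_fun1// mul1r.
Qed.

End bounded_measurable.

(** * Markov's inequality in rearrangement invariant lattices *)

Lemma lebesgue_measure_shift (R : realType) (c : R) (A : set R) :
  measurable A ->
  lebesgue_measure ((fun x => x + c) @^-1` A) = lebesgue_measure A.
Proof.
have mc : measurable_fun [set: R] (fun x : R => x + c).
  by apply: measurable_funD => //; exact: measurable_cst.
move=> mA; rewrite -[LHS]/(pushforward lebesgue_measure
  (fun x : measurableTypeR R => (x + c : measurableTypeR R)) A).
apply/esym/lebesgue_measure_unique => // _ [[u v]] _ <-.
transitivity (lebesgue_measure `]u - c, v - c]%classic).
  rewrite !lebesgue_measure_itv/= !lte_fin ltrD2r.
  by case: ifP => // _; rewrite -!EFinD; congr EFin; ring.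
congr (lebesgue_measure _); apply/seteqP.
by split => x /=; rewrite !in_itv/= ltrBlDr lerBrDr.
Qed.

Section markov_inequality.
Context {R : realType} {a b : R} (hab : a < b) (X : banach_lattice a b).
Hypothesis hX : rearrangement_invariant X.
Local Notation nrm := (bl_norm X).

Lemma measurable_modulus (D : set R) (f : R -> R[i]) :
  measurable_fun D (fun x => complex.Re (f x)) ->
  measurable_fun D (fun x => complex.Im (f x)) ->
  measurable_fun D (fun x => modulus (f x)).
Proof.
move=> mRe mIm.
have -> : (fun x => modulus (f x)) =
    Num.sqrt \o (fun x => complex.Re (f x) ^+ 2 + complex.Im (f x) ^+ 2).
  by apply/funext => x; rewrite modulusE.
apply: measurableT_comp.
  by apply: nondecreasing_measurable => // x y; exact: ler_wsqrtr.
by apply: measurable_funD; exact: measurable_funX.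
Qed.

Lemma bl_norm_shift (B : set R) (c : R) (P : {poly R[i]}) :
  measurable B -> B `<=` `[a, b] ->
  (forall x, B x -> `[a, b]%classic (x + c)) ->
  bl_set X (fun x => char_fun B x * poly_fun P (x + c)) /\
  nrm (fun x => char_fun B x * poly_fun P (x + c)) <= nrm (poly_fun P).
Proof.
move=> mB Bab Bc.
pose Pc := P \Po ('X + c%:C%:P).
have PcE x : poly_fun P (x + c) = poly_fun Pc x.
  by rewrite /poly_fun /Pc horner_comp !hornerE -rmorphD.
have Xg1 : bl_set X (fun x => char_fun B x * poly_fun P (x + c)).
  under eq_fun do rewrite PcE.
  exact: bl_char_poly.
split => //.
pose B' := (fun x => x + - c) @^-1` B.
have mB' : measurable B'.
  rewrite -[B']setTI; apply: measurable_funD => //; exact: measurable_cst.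
have Xg2 := bl_char_poly hab X B' P mB'.
rewrite (hX _ _ Xg1 Xg2); last first.
  move=> y; rewrite /distribution_fun; have [y0|y0] := leP y 0.
    congr (lebesgue_measure _); apply/seteqP.
    by split=> x /= [xab _]; split=> //; rewrite (le_trans y0)// modulus_ge0.
  have m2 : measurable [set x | `[a, b]%classic x /\
      y <= modulus (char_fun B' x * poly_fun P x)].
    have [h1 h2] := @measurable_on_char_poly R a b B' P mB'.
    apply: (@measurable_fun_le _ _ _ `[a, b] (fun=> y)) => //.
    exact: measurable_modulus.
  rewrite -[RHS](lebesgue_measure_shift _ c)//; congr (lebesgue_measure _).
  have char0 (A : set R) x z : y <= modulus (char_fun A x * z) -> A x.
    move=> h; apply: contrapT => nA; move: h.
    by rewrite char_fun0// mul0r modulus0 leNgt y0.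
  apply/seteqP; split => x /= [xab h].
    have Bx := char0 _ _ _ h; split; first exact: Bc.
    have B'x : B' (x + c) by rewrite /B'/= addrK.
    by rewrite (char_fun1 _ _ Bx) in h; rewrite (char_fun1 _ _ B'x).
  have B'x := char0 _ _ _ h; have Bx : B x by move: B'x; rewrite /B'/= addrK.
  split; first exact: Bab.
  by rewrite (char_fun1 _ _ B'x) in h; rewrite (char_fun1 _ _ Bx).
apply: bl_norm_mono => //; first exact: bl_poly.
move=> x _; rewrite modulusM -[leRHS]mul1r ler_wpM2r ?modulus_ge0//.
exact: modulus_char.
Qed.

Lemma markov_half (n : nat) (P : {poly R[i]}) (B : set R) (d : R) :
  (size P <= n.+1)%N -> d != 0 -> measurable B -> B `<=` `[a, b] ->
  (forall x t, B x -> 0 <= t <= 1 -> `[a, b]%classic (x + d * t)) ->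
  nrm (fun x => char_fun B x * poly_fun P^`() x) <=
    2 * n%:R ^+ 2 / `|d| * nrm (poly_fun P).
Proof.
move=> sP d0 mB Bab Bd.
have [l [t [t01 sl quad]]] := markov_quadrature R n.
pose F j x : R[i] := (l j / d)%:C * (char_fun B x * poly_fun P (x + d * t j)).
have FE x : char_fun B x * poly_fun P^`() x = \sum_j F j x.
  pose Q := P \Po (d%:C *: 'X + x%:C%:P).
  have sQ : (size Q <= n.+1)%N.
    rewrite (leq_trans (size_comp_poly_leq _ _))// ltnS.
    have s2 : ((size (d%:C *: 'X + x%:C%:P : {poly R[i]})%R).-1 <= 1)%N.
      rewrite -subn1 leq_subLR (leq_trans (size_polyD _ _))// geq_max.
      rewrite (leq_trans (size_scale_leq _ _)) ?size_polyX//.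
      by rewrite (leq_trans (size_polyC_leq1 _)).
    have s1 : ((size P).-1 <= n)%N by rewrite -subn1 leq_subLR add1n.
    by rewrite (leq_trans (leq_mul s1 s2))// muln1.
  have := quad Q sQ; rewrite /Q deriv_comp hornerM horner_comp.
  rewrite derivD derivC addr0 derivZ derivX hornerZ hornerC mulr1.
  rewrite hornerD hornerC hornerZ hornerX mulr0 add0r => PE.
  have dC : d%:C != 0 :> R[i].
    by rewrite -(rmorph0 (real_complex R)) (inj_eq (@complexI R)).
  have -> : poly_fun P^`() x = d%:C^-1 * (P^`().[x%:C] * d%:C).
    by rewrite mulrCA mulVf// mulr1.
  rewrite PE !mulr_sumr; apply: eq_bigr => j _; rewrite /F horner_comp.
  rewrite hornerD hornerC hornerZ hornerX /poly_fun.
  have -> : (x + d * t j)%:C = d%:C * (t j)%:C + x%:C :> R[i].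
    by rewrite -rmorphM -rmorphD addrC.
  have -> : (l j / d)%:C = (l j)%:C / d%:C :> R[i] by rewrite -fmorphV -rmorphM.
  by rewrite [RHS]mulrCA; congr (_ * _); rewrite mulrA (mulrC _^-1).
have XS j := @bl_norm_shift B (d * t j) P mB Bab
  (fun x Bx => Bd x (t j) Bx (t01 j)).
have XF j : bl_set X (F j) by apply: bl_scale; have [] := XS j.
under eq_fun do rewrite FE.
rewrite (le_trans (bl_norm_sum hab X _ _ _ _))//.
apply: (@le_trans _ _ (\sum_j `|l j| / `|d| * nrm (poly_fun P))).
  apply: ler_sum => j _; have [h1 h2] := XS j.
  by rewrite /F bl_normZ// modulusC normrM normfV ler_wpM2l//.
rewrite -!mulr_suml ler_wpM2r//.
  by apply: (bl_norm_ge0 hab); exact: bl_poly.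
by rewrite ler_wpM2r// invr_ge0.
Qed.

Lemma markov_inequality (n : nat) (P : {poly R[i]}) : (size P <= n.+1)%N ->
  nrm (poly_fun P^`()) <= 8 * n%:R ^+ 2 / (b - a) * nrm (poly_fun P).
Proof.
move=> sP; pose d := (b - a) / 2; pose m := a + d.
have d0 : 0 < d by rewrite divr_gt0// subr_gt0.
have bE : b = a + 2 * d by rewrite /d; field.
have mab : `[a, m] `<=` `[a, b]%classic.
  by move=> x /=; rewrite !in_itv/= /m => /andP[? ?]; apply/andP; split; lra.
have mab' : `[m, b] `<=` `[a, b]%classic.
  by move=> x /=; rewrite !in_itv/= /m => /andP[? ?]; apply/andP; split; lra.
have h1 : nrm (fun x => char_fun `[a, m] x * poly_fun P^`() x) <=
    2 * n%:R ^+ 2 / `|d| * nrm (poly_fun P).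
  apply: markov_half => //; first by rewrite gt_eqF.
  move=> x t /=; rewrite !in_itv/= /m => /andP[? ?] /andP[? ?].
  by apply/andP; split; nra.
have h2 : nrm (fun x => char_fun `[m, b] x * poly_fun P^`() x) <=
    2 * n%:R ^+ 2 / `|- d| * nrm (poly_fun P).
  apply: markov_half => //; first by rewrite lt_eqF// oppr_lt0.
  move=> x t /=; rewrite !in_itv/= /m => /andP[? ?] /andP[? ?].
  by apply/andP; split; nra.
have X1 := bl_char_poly hab X `[a, m] P^`() (measurable_itv _).
have X2 := bl_char_poly hab X `[m, b] P^`() (measurable_itv _).
have h3 : nrm (poly_fun P^`()) <= nrm (fun x =>
    char_fun `[a, m] x * poly_fun P^`() x +
    char_fun `[m, b] x * poly_fun P^`() x).
  apply: bl_norm_mono => [||x xab]; [exact: bl_poly|exact: bl_add|].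
  rewrite -mulrDl modulusM -[leLHS]mul1r ler_wpM2r ?modulus_ge0//.
  rewrite /char_fun -rmorphD modulusC ger0_norm ?addr_ge0// !indicE.
  move: xab; rewrite /= in_itv/= => /andP[ax xb]; have [xm|xm] := leP x m.
    by rewrite mem_set ?lerDl//= in_itv/= ax.
  by rewrite (@mem_set _ `[m, b]%classic x) ?lerDr//= in_itv/= xb ltW.
rewrite (le_trans h3)// (le_trans (bl_normD X1 X2))// (le_trans (lerD h1 h2))//.
rewrite normrN gtr0_norm// le_eqVlt; apply/orP; left; apply/eqP.
have -> : b - a = 2 * d by rewrite /d; field.
by field; rewrite gt_eqF.
Qed.

Lemma markov_inequality_iter (n : nat) (P : {poly R[i]}) (j : nat) :
  (size P <= n.+1)%N ->
  nrm (poly_fun P^`(j)) <= (8 * n%:R ^+ 2 / (b - a)) ^+ j * nrm (poly_fun P).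
Proof.
move=> sP.
have sPj i : (size P^`(i) <= n.+1)%N.
  elim: i => [//|i IH]; rewrite derivnS.
  have [->|/lt_size_deriv/ltnW/leq_trans] := eqVneq P^`(i) 0; last exact.
  by rewrite derivC size_poly0.
have := fun i => markov_inequality _ _ (sPj i); set D := 8 * _ / _ => step.
have D0 : 0 <= D by rewrite divr_ge0// subr_ge0 ltW.
elim: j => [|j IH]; first by rewrite expr0 mul1r.
by rewrite derivnS (le_trans (step j))// exprS -mulrA ler_wpM2l.
Qed.

End markov_inequality.

(** * Sampling *)

Lemma exp_partial_sum_le (R : realType) (q : R) (n : nat) : 0 <= q ->
  \sum_(j < n) q ^+ j.+1 / j.+1`!%:R <= expR q - 1.
Proof.
move=> q0; rewrite lerBrDl.
have := nondecreasing_cvgn_le _ (is_cvg_series_exp_coeff q) n.+1.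
rewrite /series/= big_mkord big_ord_recl/= /exp_coeff /= expr0 fact0 divr1.
apply; apply/nondecreasing_seqP => k; rewrite !big_mkord big_ord_recr/= lerDl.
by rewrite divr_ge0// exprn_ge0.
Qed.

Section sampling.
Context {R : realType} {a b : R} (hab : a < b) (X : banach_lattice a b).
Hypothesis hX : rearrangement_invariant X.
Local Notation nrm := (bl_norm X).

Definition taylor_majorant (P : {poly R[i]}) (n : nat) (h : R) : R -> R[i] :=
  fun x => \sum_(j < n)
    (h ^+ j.+1)%:C * (modulus (poly_fun P^`N(j.+1) x))%:C.

Lemma taylor_majorantE P n h x : taylor_majorant P n h x =
  (\sum_(j < n) h ^+ j.+1 * modulus (poly_fun P^`N(j.+1) x))%:C.
Proof. by rewrite rmorph_sum; apply: eq_bigr => j _; rewrite rmorphM. Qed.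

Lemma bl_modulus_poly (P : {poly R[i]}) :
  bl_set X (fun x => (modulus (poly_fun P x))%:C).
Proof. by apply: bl_abs; exact: bl_poly. Qed.

Lemma bl_norm_modulus_poly (P : {poly R[i]}) :
  nrm (fun x => (modulus (poly_fun P x))%:C) <= nrm (poly_fun P).
Proof.
apply: bl_norm_mono; [exact: bl_modulus_poly|exact: bl_poly|move=> x _].
by rewrite modulusC ger0_norm ?modulus_ge0.
Qed.

Lemma bl_taylor_majorant (P : {poly R[i]}) n h :
  bl_set X (taylor_majorant P n h).
Proof.
by apply: bl_sum => // j _; apply: bl_scale; exact: bl_modulus_poly.
Qed.

Lemma taylor_majorantP (P : {poly R[i]}) n h x y :
  (size P <= n.+1)%N -> `|y - x| <= h ->
  modulus (poly_fun P y - poly_fun P x) <= modulus (taylor_majorant P n h x).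
Proof.
move=> sP yx; have h0 : 0 <= h := le_trans (normr_ge0 _) yx.
rewrite taylor_majorantE modulusC ger0_norm; last first.
  by apply: sumr_ge0 => j _; rewrite mulr_ge0 ?exprn_ge0 ?modulus_ge0.
have -> : poly_fun P y = P.[x%:C + (y - x)%:C].
  by rewrite -rmorphD addrC subrK.
rewrite (nderiv_taylor_wide (mulrC _ _) sP) big_ord_recl/= nderivn0 expr0 mulr1.
rewrite addrC addKr (le_trans (modulus_sum _ _ _))//; apply: ler_sum => j _.
rewrite modulusM mulrC ler_wpM2r ?modulus_ge0//.
by rewrite -rmorphXn modulusC normrX lerXn2r ?nnegrE.
Qed.

Lemma bl_norm_nderiv (n : nat) (P : {poly R[i]}) (j : nat) :
  (size P <= n.+1)%N ->
  nrm (poly_fun P^`N(j)) <=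
    (8 * n%:R ^+ 2 / (b - a)) ^+ j / j`!%:R * nrm (poly_fun P).
Proof.
move=> sP; have f0 : 0 < j`!%:R :> R by rewrite ltr0n fact_gt0.
rewrite mulrAC ler_pdivlMr// mulrC.
have -> : j`!%:R = modulus (j`!%:R : R[i]) :> R.
  by rewrite -(rmorph_nat (real_complex R)) modulusC ger0_norm// ltW.
rewrite -bl_normZ; last exact: bl_poly.
have := @markov_inequality_iter R a b hab X hX n P j sP.
congr (_ <= _); congr (nrm _); apply/funext => x.
by rewrite /poly_fun nderivn_def hornerMn mulr_natl.
Qed.

Lemma bl_norm_taylor_majorant (n : nat) (P : {poly R[i]}) (h : R) :
  (size P <= n.+1)%N -> 0 <= h ->
  nrm (taylor_majorant P n h) <=
    (expR (8 * n%:R ^+ 2 / (b - a) * h) - 1) * nrm (poly_fun P).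
Proof.
move=> sP h0; set D := 8 * _ / _.
have D0 : 0 <= D by rewrite divr_ge0// subr_ge0 ltW.
have P0 : 0 <= nrm (poly_fun P) by apply: (bl_norm_ge0 hab); exact: bl_poly.
rewrite (le_trans (bl_norm_sum hab X _ _ _ _))// => [j|].
  by apply: bl_scale; exact: bl_modulus_poly.
apply: (@le_trans _ _
  (\sum_(j < n) (D * h) ^+ j.+1 / j.+1`!%:R * nrm (poly_fun P))).
  apply: ler_sum => j _; rewrite bl_normZ; last exact: bl_modulus_poly.
  rewrite modulusC ger0_norm ?exprn_ge0//.
  have := le_trans (bl_norm_modulus_poly _) (bl_norm_nderiv n P j.+1 sP).
  move/(ler_wpM2l (exprn_ge0 j.+1 h0)); rewrite -/D => /le_trans; apply.
  by rewrite (exprMn _ D h) (mulrC (D ^+ _) (h ^+ _)) -!mulrA.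
by rewrite -mulr_suml ler_wpM2r// exp_partial_sum_le// mulr_ge0.
Qed.

Lemma sub_Omega (N k : nat) : (0 < N)%N -> (1 <= k <= N)%N ->
  Omega a b N k `<=` `[a, b].
Proof.
move=> N0 /andP[k1 kN] x; rewrite /Omega /= !in_itv/= => /andP[h1 h2].
have N0' : 0 < N%:R :> R by rewrite ltr0n.
have ba : 0 < b - a by rewrite subr_gt0.
apply/andP; split.
  by rewrite (le_trans _ h1)// lerDl divr_ge0// mulr_ge0 ?subr_ge0 ?ler1n// ltW.
rewrite (le_trans h2)// -lerBrDl ler_pdivrMr// ler_wpM2l ?ler_nat//.
exact: ltW.
Qed.

Lemma bl_sample_fun (P : {poly R[i]}) (N : nat) (x : nat -> R) : (0 < N)%N ->
  bl_set X (sample_fun a b P N x).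
Proof.
move=> N0; apply: bl_sum => // k; rewrite mem_index_iota ltnS => kN.
apply: bl_scale; apply: bl_char_sub => //; first exact: measurable_itv.
exact: sub_Omega.
Qed.

Lemma OmegaP (N k : nat) (t : R) : (0 < N)%N ->
  Omega a b N k t <-> k%:R - 1 <= (t - a) * N%:R / (b - a) <= k%:R.
Proof.
move=> N0; have N0' : 0 < N%:R :> R by rewrite ltr0n.
have ba : 0 < b - a by rewrite subr_gt0.
rewrite /Omega /= in_itv/=.
have -> : (a + (b - a) * (k%:R - 1) / N%:R <= t) =
    (k%:R - 1 <= (t - a) * N%:R / (b - a)).
  by rewrite -lerBrDl ler_pdivrMr// ler_pdivlMr// mulrC.
have -> // : (t <= a + (b - a) * k%:R / N%:R) =
    ((t - a) * N%:R / (b - a) <= k%:R).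
by rewrite -lerBlDl ler_pdivlMr// ler_pdivrMr// (mulrC (b - a)).
Qed.

Lemma sample_fun_ae (P : {poly R[i]}) (N : nat) (x : nat -> R) : (0 < N)%N ->
  ae_on a b (fun t => exists k, [/\ (1 <= k <= N)%N, Omega a b N k t &
    sample_fun a b P N x t = (modulus (poly_fun P (x k)))%:C]).
Proof.
move=> N0; have N0' : 0 < N%:R :> R by rewrite ltr0n.
have ba : 0 < b - a by rewrite subr_gt0.
pose z t := (t - a) * N%:R / (b - a).
pose G : set R := range (fun i : nat => a + i%:R * (b - a) / N%:R).
have cG : countable G.
  exact: sub_countable (card_image_le _ _) (countableP _).
have mG : measurable G by exact: countable_measurable.
exists G; split => //; first exact: countable_lebesgue_measure0.
move=> t /= nt; apply: contrapT => tG; apply: nt => tab.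
have zi i : z t != i%:R.
  apply/eqP => ztE; apply: tG; exists i => //.
  by rewrite -ztE /z; field; rewrite !gt_eqF.
move: tab; rewrite /= in_itv/= => /andP[ta tb].
have z0 : 0 <= z t by rewrite divr_ge0 ?mulr_ge0// ?subr_ge0// ltW.
have zN : z t <= N%:R.
  by rewrite ler_pdivrMr// mulrC ler_pM2l// lerD2r.
have /andP[pz zp] := truncn_itv z0; set p := Num.truncn _ in pz zp.
have pN : (p < N)%N.
  rewrite ltn_neqAle -(ler_nat R) (le_trans pz zN) andbT.
  apply/eqP => pE; have /eqP := zi N; apply; apply/eqP.
  by rewrite eq_le zN -pE.
exists p.+1; split; first by rewrite ltnS.
  by apply/OmegaP => //; rewrite -/(z t) -natr1 addrK natr1 pz ltW.
rewrite /sample_fun (bigD1_seq p.+1) ?iota_uniq//=; last first.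
  by rewrite mem_index_iota/= ltnS.
rewrite char_fun1 ?mulr1; last first.
  by apply/OmegaP => //; rewrite -/(z t) -natr1 addrK natr1 pz ltW.
rewrite big_seq_cond big1 ?addr0// => i /andP[].
rewrite mem_index_iota => /andP[i1 iN] ip.
rewrite char_fun0 ?mulr0// => /OmegaP => /(_ N0) /andP[].
rewrite -/(z t) => iz zi'.
move: ip; rewrite neq_ltn => /orP[ip|ip].
  have : z t = i%:R.
    by apply/eqP; rewrite eq_le zi'/= (le_trans _ pz)// ler_nat.
  by apply/eqP.
have : p.+1%:R <= i%:R - 1 :> R by rewrite lerBrDr natr1 ler_nat.
by move=> /le_trans => /(_ _ iz); rewrite leNgt zp.
Qed.

Lemma bl_norm_sample_fun (n N : nat) (P : {poly R[i]}) (x : nat -> R) :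
  (size P <= n.+1)%N -> (0 < N)%N ->
  (forall k, (1 <= k <= N)%N -> Omega a b N k (x k)) ->
  let e := expR (8 * n%:R ^+ 2 / N%:R) in
  (2 - e) * nrm (poly_fun P) <= nrm (sample_fun a b P N x) /\
  nrm (sample_fun a b P N x) <= e * nrm (poly_fun P).
Proof.
move=> sP N0 xO /=; set e := expR _; pose h := (b - a) / N%:R.
have N0' : 0 < N%:R :> R by rewrite ltr0n.
have ba : 0 < b - a by rewrite subr_gt0.
have h0 : 0 <= h by rewrite divr_ge0 ?ltW.
have := bl_norm_taylor_majorant n P h sP h0.
have -> : 8 * n%:R ^+ 2 / (b - a) * h = 8 * n%:R ^+ 2 / N%:R.
  by rewrite /h; field; rewrite !gt_eqF.
rewrite -/e; set T := taylor_majorant P n h => nT.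
have XT : bl_set X T by exact: bl_taylor_majorant.
have XS := @bl_sample_fun P N x N0.
have XP := bl_poly hab X P; have XaP := bl_modulus_poly P.
have TE t : modulus (T t) =
    \sum_(j < n) h ^+ j.+1 * modulus (poly_fun P^`N(j.+1) t).
  rewrite /T taylor_majorantE modulusC ger0_norm//.
  by apply: sumr_ge0 => j _; rewrite mulr_ge0 ?exprn_ge0 ?modulus_ge0.
have TC t : T t = (modulus (T t))%:C by rewrite TE /T taylor_majorantE.
have close k t : (1 <= k <= N)%N -> Omega a b N k t -> `|x k - t| <= h.
  move=> kN; have := xO k kN; rewrite /Omega /= !in_itv/=.
  move=> /andP[h1 h2] /andP[h3 h4].
  have hE : a + (b - a) * k%:R / N%:R - (a + (b - a) * (k%:R - 1) / N%:R) = h.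
    by rewrite /h; field; rewrite gt_eqF.
  by rewrite ler_norml; apply/andP; split; lra.
have sample_le : nrm (sample_fun a b P N x) <= e * nrm (poly_fun P).
  apply: (@le_trans _ _ (nrm (fun t => (modulus (poly_fun P t))%:C + T t))).
    apply: bl_norm_le => //; first exact: bl_add.
    move: (sample_fun_ae P N x N0); apply: ae_onS => t _ [k [kN Okt ->]].
    rewrite TC -rmorphD !modulusC !ger0_norm ?addr_ge0 ?modulus_ge0//.
    have := modulusD (poly_fun P (x k) - poly_fun P t) (poly_fun P t).
    rewrite subrK => /le_trans; apply; rewrite addrC lerD2l.
    by apply: taylor_majorantP => //; exact: close kN Okt.
  rewrite (le_trans (bl_normD XaP XT))//.
  have := bl_norm_modulus_poly P; move: nT; rewrite mulrBl mul1r; lra.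
split => //.
suff : nrm (poly_fun P) <= nrm (sample_fun a b P N x) + nrm T.
  by move: nT; rewrite mulrBl mul1r mulrBl; lra.
apply: (@le_trans _ _ (nrm (fun t => sample_fun a b P N x t + T t))).
  2: exact: bl_normD.
apply: bl_norm_le => //; first exact: bl_add.
move: (sample_fun_ae P N x N0); apply: ae_onS => t _ [k [kN Okt ->]].
rewrite TC -rmorphD !modulusC !ger0_norm ?addr_ge0 ?modulus_ge0//.
have := modulusD (poly_fun P t - poly_fun P (x k)) (poly_fun P (x k)).
rewrite subrK => /le_trans; apply; rewrite addrC lerD2l modulusB.
by apply: taylor_majorantP => //; exact: close kN Okt.
Qed.

End sampling.

Theorem theorem5p2 (R : realType) (a b : R) (hab : a < b)
    (X : banach_lattice a b) (hX : rearrangement_invariant X)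
    (eps : R) (heps : 0 < eps) :
  exists c1 c2 : R, 0 < c1 /\ 0 < c2 /\
    forall (n N : nat) (P : {poly R[i]}) (x : nat -> R),
      (size P <= n.+1)%N ->
      (0 < N)%N ->
      (8 / ln 2 + eps) * n%:R ^+ 2 <= N%:R ->
      (forall k : nat, (1 <= k <= N)%N -> Omega a b N k (x k)) ->
      c1 * bl_norm X (poly_fun P) <= bl_norm X (sample_fun a b P N x) /\
      bl_norm X (sample_fun a b P N x) <= c2 * bl_norm X (poly_fun P).
Proof.
have ln2 : 0 < ln 2 :> R by rewrite ln_gt0// ltr1n.
have d0 : 0 < 8 / ln 2 + eps :> R by rewrite addr_gt0// divr_gt0.
pose q := 8 / (8 / ln 2 + eps).
have qln2 : q < ln 2.
  rewrite /q ltr_pdivrMr// mulrDr mulrCA divff ?gt_eqF// mulr1 ltrDl.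
  exact: mulr_gt0.
have e2 : expR q < 2 by rewrite -[ltRHS]lnK ?posrE// ltr_expR.
exists (2 - expR q), (expR q); split; first by rewrite subr_gt0.
split; first exact: expR_gt0.
move=> n N P x sP N0 nN xO.
have N0' : 0 < N%:R :> R by rewrite ltr0n.
have [lo hi] := bl_norm_sample_fun hab X hX n N P x sP N0 xO.
have P0 : 0 <= bl_norm X (poly_fun P).
  by apply: (bl_norm_ge0 hab); exact: bl_poly.
have e_le : expR (8 * n%:R ^+ 2 / N%:R) <= expR q.
  rewrite ler_expR ler_pdivrMr// /q mulrAC ler_pdivlMr// -mulrA ler_pM2l//.
  by rewrite mulrC.
split; first by apply: le_trans lo; rewrite ler_wpM2r// lerD2l lerN2.
by apply: (le_trans hi); rewrite ler_wpM2r.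
Qed.
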